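(* Let $d\ge1$ be an integer and let $R\ge 3\sqrt d$ be real. Let $\Lambda_{d,R}=\mathbb Z^d\cap\{x\in\mathbb R^d:\|x\|_2\le R\}$, and let $e_d=\mathcal E(B_d)/v_d^3$ be the normalized continuous additive energy of the closed Euclidean unit ball $B_d\subset\mathbb R^d$, with $v_d=\operatorname{vol}(B_d)$. Then \[ \left|\log\frac{E(\Lambda_{d,R})}{|\Lambda_{d,R}|^3}-\log e_d\right|\le 12\,\frac{d^{3/2}}{R}. \]
   Context: For a finite subset $A$ of an abelian group, the additive energy of $A$ is $E(A)=\#\{(a_1,a_2,a_3,a_4)\in A^4: a_1+a_2=a_3+a_4\}$. For a measurable set $S\subset\mathbb R^d$ of finite measure, its continuous additive energy is \[ \mathcal E(S)=\int_{(\mathbb R^d)^3}\mathbf 1_S(x_1)\mathbf 1_S(x_2)\mathbf 1_S(x_3)\mathbf 1_S(x_1+x_2-x_3)\,dx_1\,dx_2\,dx_3. \] $B_d=\{x\in\mathbb R^d:\|x\|_2\le1\}$, where $\|\cdot\|_2$ is the Euclidean norm, and $\operatorname{vol}$ is Lebesgue measure. *)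

(* Defs.v *)
From HB Require Import structures.
From mathcomp Require Import all_boot all_order all_algebra finmap.
From mathcomp Require Import all_classical all_reals all_analysis.

Set Implicit Arguments.
Unset Strict Implicit.
Unset Printing Implicit Defensive.

Import Order.TTheory GRing.Theory Num.Theory.
Import numFieldNormedType.Exports.

Local Open Scope classical_set_scope.
Local Open Scope ring_scope.

(* Row vectors carry the sigma-algebra generated by the coordinate functions,
   as the library does for [n.-tuple T]; for T = R it is the Borel one. *)
Definition measure_rV_display : measure_display -> measure_display.
Proof. exact. Qed.

Section measurable_rV.
Context {disp : measure_display} {T : measurableType disp}.
Variable n : nat.

Definition rV_coord (i : 'I_n) (x : 'rV[T]_n) : T := x ord0 i.

Let rV_set0 : g_sigma_preimage rV_coord set0.
Proof. exact: sigma_algebra0. Qed.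

Let rV_setC A : g_sigma_preimage rV_coord A -> g_sigma_preimage rV_coord (~` A).
Proof. exact: sigma_algebraC. Qed.

Let rV_bigcup (F : (set 'rV[T]_n)^nat) :
  (forall i, g_sigma_preimage rV_coord (F i)) ->
  g_sigma_preimage rV_coord (\bigcup_i (F i)).
Proof. exact: sigma_algebra_bigcup. Qed.

HB.instance Definition _ := @isMeasurable.Build (measure_rV_display disp)
  'rV[T]_n (g_sigma_preimage rV_coord) rV_set0 rV_setC rV_bigcup.

End measurable_rV.

Lemma measurable_rV_coord disp (T : measurableType disp) n (i : 'I_n) :
  measurable_fun [set: 'rV[T]_n] (@rV_coord disp T n i).
Proof.
move=> _ Y mY; rewrite setTI; apply: sub_sigma_algebra => /=.
rewrite -bigcup_seq/=; exists i => /=; first by rewrite mem_index_enum.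
by exists Y => //; rewrite setTI.
Qed.

Lemma measurable_fun_rVP d1 d2 (T1 : measurableType d1)
    (T2 : measurableType d2) n (f : T1 -> 'rV[T2]_n) :
  (forall i, measurable_fun [set: T1] (fun x => f x ord0 i)) ->
  measurable_fun [set: T1] f.
Proof.
move=> mf _ A mA.
suff : preimage_set_system setT f (g_sigma_preimage (@rV_coord _ T2 n))
       `<=` @measurable _ T1 by apply; exists A.
rewrite -g_sigma_preimage_comp.
apply: smallest_sub; first exact: sigma_algebra_measurable.
by rewrite -bigcup_seq; apply: bigcup_sub => i _ B [C mC <-]; exact: mf.
Qed.

(* The library proves this locally, but its canonical instance is shadowed by the
   one for products of subprobabilities. *)
Lemma product_measure1_sigma_finite d1 d2 (T1 : measurableType d1)
    (T2 : measurableType d2) (R : realType)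
    (m1 : {sigma_finite_measure set T1 -> \bar R})
    (m2 : {sigma_finite_measure set T2 -> \bar R}) :
  sigma_finite [set: T1 * T2] (m1 \x m2)%E.
Proof.
have /sigma_finiteP[F [TF ndF Foo]] := sigma_finiteT m1.
have /sigma_finiteP[G [TG ndG Goo]] := sigma_finiteT m2.
exists (fun n => F n `*` G n).
  rewrite -setXTT TF TG predeqE => -[x y]; split.
    move=> [/= [n _ Fnx] [k _ Gky]]; exists (maxn n k) => //; split.
    - by move: x Fnx; exact/subsetPset/ndF/leq_maxl.
    - by move: y Gky; exact/subsetPset/ndG/leq_maxr.
  by move=> [n _ []/= ? ?]; split; exists n.
move=> k; have [? ?] := Foo k; have [? ?] := Goo k.
split; first exact: measurableX.
by rewrite product_measure1E// lte_mul_pinfty// ge0_fin_numE.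
Qed.

Section lebesgue_rV.
Context {R : realType}.

Definition rV_cons n (p : R * 'rV[R]_n) : 'rV[R]_n.+1 :=
  \row_i (if unlift ord0 i is Some j then p.2 ord0 j else p.1).

Lemma measurable_rV_cons n : measurable_fun [set: R * 'rV[R]_n] (@rV_cons n).
Proof.
apply: measurable_fun_rVP => i; under eq_fun do rewrite mxE.
case: unliftP => [j _|_]; last exact: measurable_fst.
by apply: (measurableT_comp (measurable_rV_coord j)).
Qed.

Section step.
Context n (mu : {sigma_finite_measure set 'rV[R]_n -> \bar R}).
Local Open Scope ereal_scope.

Definition lebesgue_rV_step : set 'rV[R]_n.+1 -> \bar R :=
  pushforward (@lebesgue_measure R \x mu) (@rV_cons n).

Let mcons (A : set 'rV[R]_n.+1) :
  measurable A -> measurable (@rV_cons n @^-1` A).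
Proof. by move=> mA; rewrite -[X in measurable X]setTI; exact: measurable_rV_cons. Qed.

Let step0 : lebesgue_rV_step set0 = 0.
Proof. by rewrite /lebesgue_rV_step /pushforward preimage_set0 measure0. Qed.

Let step_ge0 A : 0 <= lebesgue_rV_step A.
Proof. by rewrite /lebesgue_rV_step /pushforward; exact: measure_ge0. Qed.

Let step_sigma_additive : semi_sigma_additive lebesgue_rV_step.
Proof.
move=> F mF tF mUF; rewrite /lebesgue_rV_step /pushforward preimage_bigcup.
apply: measure_semi_sigma_additive.
- by move=> k; exact: mcons.
- apply/trivIsetP => i j _ _ ij; rewrite -preimage_setI.
  by move/trivIsetP : tF => /(_ _ _ _ _ ij) ->//; rewrite preimage_set0.
- by rewrite -preimage_bigcup; exact: mcons.
Qed.

HB.instance Definition _ := isMeasure.Build _ _ _ lebesgue_rV_step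
  step0 step_ge0 step_sigma_additive.

Let step_sigma_finite : sigma_finite setT lebesgue_rV_step.
Proof.
have [F FT Foo] := product_measure1_sigma_finite (@lebesgue_measure R) mu.
have hd : measurable_fun [set: 'rV[R]_n.+1]
    (fun x : 'rV[R]_n.+1 => (x ord0 ord0, \row_j x ord0 (lift ord0 j) : 'rV[R]_n)).
  apply/measurable_fun_pair; first exact: measurable_rV_coord.
  apply: measurable_fun_rVP => j; under eq_fun do rewrite mxE.
  exact: measurable_rV_coord.
set g := (X in measurable_fun _ X) in hd.
have gK p : g (rV_cons p) = p.
  case: p => x v; rewrite /g /rV_cons mxE unlift_none /=; congr pair.
  by apply/rowP => j; rewrite !mxE liftK.
exists (fun k => g @^-1` F k); first by rewrite -preimage_bigcup -FT preimage_setT.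
move=> k; have [mFk Fkoo] := Foo k; split.
  by rewrite -[X in measurable X]setTI; exact: hd.
rewrite /lebesgue_rV_step /pushforward -comp_preimage.
by rewrite (_ : g \o _ = id)//; apply/funext => p /=; rewrite gK.
Qed.

HB.instance Definition _ := Measure_isSigmaFinite.Build _ _ _ lebesgue_rV_step
  step_sigma_finite.

End step.

(* The d-fold product of the one-dimensional Lebesgue measure. *)
Fixpoint lebesgue_rV n : {sigma_finite_measure set 'rV[R]_n -> \bar R} :=
  match n with
  | 0 => dirac (0 : 'rV[R]_0)
  | m.+1 => lebesgue_rV_step (lebesgue_rV m)
  end.

Lemma lebesgue_rV_box n (A : 'I_n -> set R) :
  (forall i, measurable (A i)) ->
  lebesgue_rV n [set x : 'rV[R]_n | forall i, A i (x ord0 i)] =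
  (\big[*%E/1%E]_i lebesgue_measure (A i))%E.
Proof.
elim: n A => [|n IH] A mA.
  by rewrite big_ord0 /= diracE mem_set// => -[].
rewrite big_ord_recl -(IH (fun i => A (lift ord0 i)))// -product_measure1E//.
  rewrite /= /lebesgue_rV_step /pushforward; congr (product_measure1 _ _ _).
  apply/seteqP; split => [[x v] /= xv|[x v] /= [x0 v0] i].
    split; first by have := xv ord0; rewrite mxE unlift_none.
    by move=> i; have := xv (lift ord0 i); rewrite mxE liftK.
  by rewrite mxE; case: unliftP => [j ->|->].
  exact: mA.
rewrite [X in measurable X](_ : _ = \bigcap_(i in [set: 'I_n])
    ((fun x : 'rV[R]_n => x ord0 i) @^-1` A (lift ord0 i))); last first.
  by apply/seteqP; split => x /= xA i => [_|]; exact: xA.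
apply: fin_bigcap_measurable => // i _.
rewrite -[X in measurable X]setTI.
exact: measurable_rV_coord.
Qed.

End lebesgue_rV.

Definition additive_energy (G : zmodType) (A : {fset G}) : nat :=
  #|` [fset q in (A `*` A) `*` (A `*` A) | (q.1.1 + q.1.2 == q.2.1 + q.2.2)%R]%fset|.

Definition continuous_energy (R : realType) n (S : set 'rV[R]_n) : \bar R :=
  (\int[(lebesgue_rV n \x lebesgue_rV n) \x lebesgue_rV n]_p
    (\1_S p.1.1 * \1_S p.1.2 * \1_S p.2 * \1_S (p.1.1 + p.1.2 - p.2)%R)%:E)%E.

(* The library's norm on row vectors is the sup norm. *)
Definition norm2 (R : realType) n (x : 'rV[R]_n) : R := Num.sqrt (\sum_i x ord0 i ^+ 2).

Definition ball2 (R : realType) n (r : R) : set 'rV[R]_n :=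
  [set x | norm2 x <= r].
Arguments ball2 {R} n r _.

Definition integer_points (R : realType) n : set 'rV[R]_n :=
  [set x | forall i, x ord0 i \is a Num.int].
Arguments integer_points {R} n _.

Lemma finite_lattice_ball (R : realType) n (r : R) :
  finite_set (integer_points n `&` ball2 n r).
Proof.
pose N := (Num.truncn r).+1.
pose h (f : {ffun 'I_n -> 'I_(N + N).+1}) : 'rV[R]_n :=
  \row_i ((f i)%:R - N%:R).
apply: (@sub_finite_set _ _ (range h)); last exact/finite_image/finite_finset.
move=> x [xint xr]; rewrite /ball2 /= in xr.
have xN i : `|x ord0 i| <= N%:R.
  apply: (@le_trans _ _ (norm2 x)).
    rewrite -sqrtr_sqr ler_sqrt ?sumr_ge0// => [|j _]; last exact: sqr_ge0.
    rewrite (bigD1 i)//= lerDl sumr_ge0// => j _; exact: sqr_ge0.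
  by apply/(le_trans xr)/ltW; exact: truncnS_gt.
have xE i : exists k : 'I_(N + N).+1, x ord0 i = k%:R - N%:R.
  have /intrP[m xm] := xint i.
  move: (xN i); rewrite xm ler_norml => /andP[m1 m2].
  have mN : 0 <= m + N%:Z.
    by rewrite -(ler0z R) rmorphD/= -lerBlDr sub0r.
  have mNN : (absz (m + N%:Z)%R < (N + N).+1)%N.
    by rewrite ltnS -lez_nat gez0_abs// PoszD lerD2r -(ler_int R).
  exists (Ordinal mNN) => /=.
  by rewrite -[_%:R]/((Posz _)%:~R) gez0_abs// rmorphD/= addrK.
have [f fE] := choice xE.
exists [ffun i => f i] => //; apply/rowP => i.
by rewrite mxE ffunE -fE.
Qed.

(* [fset_set] of an infinite set is empty: see [finite_lattice_ball]. *)
Definition lattice_ball (R : realType) n (r : R) : {fset 'rV[R]_n} :=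
  fset_set (integer_points n `&` ball2 n r).

Definition normalized_ball_energy (R : realType) n : R :=
  fine (continuous_energy (ball2 n 1)) / fine (lebesgue_rV n (ball2 n 1)) ^+ 3.

(* Main.v *)
From HB Require Import structures.
Require Import Defs.
From mathcomp Require Import all_boot all_order all_algebra finmap.
From mathcomp Require Import all_classical all_reals all_analysis.
From mathcomp Require Import measurable_realfun zify ring lra.

Set Implicit Arguments.
Unset Strict Implicit.
Unset Printing Implicit Defensive.

Import Order.TTheory GRing.Theory Num.Theory.

Local Open Scope ring_scope.

(** The unit cubes centred at integer points tile R^n, and every point of such a
    cube is within s/2 of its centre, s = sqrt n. Hence |L|, for L the set of
    integer points of the ball of radius r, lies between the volumes of the balls
    of radii r -/+ s/2. Likewise, for x_i in the cube centred at a_i, the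
    point x1 + x2 - x3 is within 3s/2 of a1 + a2 - a3, so E(L) lies between the
    continuous energies of the balls of radii r -/+ 3s/2. By homogeneity these
    volumes and energies are v_n and E(B_n) times the n-th and 3n-th powers of
    the radii. In the logarithm of the ratio, the error is at most
    3n (ln x - ln y) <= 3n (x - y) / y with x - y = 2s and y >= r - 3s/2 >= r/2. *)

(** * Counting finite families through cells of measure one *)

Section unit_cells.
Context d (T : measurableType d) (R : realType) (mu : {measure set T -> \bar R}).
Context (I : choiceType) (L : {fset I}) (C : I -> set T) (B : set T).
Hypothesis mC : forall i, i \in L -> measurable (C i).
Hypothesis C1 : forall i, i \in L -> mu (C i) = 1%E.
Hypothesis mB : measurable B.

Let sumC : (\sum_(i \in [set` L]) mu (C i))%E = (#|` L|%:R)%:E.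
Proof.
rewrite fsbig_finite//= set_fsetK (eq_big_seq _ C1) card_fset_sum1.
by rewrite natr_sum sumEFin.
Qed.

(** Disjointness turns the cardinality into the measure of a union of cells inside [B]. The index
    type is left general so as to serve both lattice points and additive quadruples. *)
Lemma card_le_measure : trivIset [set` L] C ->
  (forall i, i \in L -> (C i `<=` B)%classic) -> ((#|` L|%:R)%:E <= mu B)%E.
Proof.
move=> tC CB; rewrite -sumC -measure_fin_bigcup//.
apply: le_measure; rewrite ?inE//.
  exact: fin_bigcup_measurable.
by move=> x [i /= iL] Cx; exact: CB Cx.
Qed.

(** Finite subadditivity over a cover of [B] by cells of measure one. *)
Lemma measure_le_card : (B `<=` \bigcup_(i in [set` L]) C i)%classic ->
  (mu B <= (#|` L|%:R)%:E)%E.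
Proof. by move=> BC; rewrite -sumC; exact: content_sub_fsum. Qed.

End unit_cells.

(** * Scaling of product measures and of Lebesgue measure under dilations *)

Lemma product_measure1_preimage d1 d2 (T1 : measurableType d1)
    (T2 : measurableType d2) (R : realType)
    (m1 : {measure set T1 -> \bar R})
    (m2 : {sigma_finite_measure set T2 -> \bar R})
    (f1 : T1 -> T1) (f2 : T2 -> T2) (k1 k2 : {nonneg R}) :
  measurable_fun setT f1 ->
  (forall A, measurable A -> m1 (f1 @^-1` A)%classic = (k1%:num%:E * m1 A)%E) ->
  (forall A, measurable A -> m2 (f2 @^-1` A)%classic = (k2%:num%:E * m2 A)%E) ->
  forall A, measurable A ->
  (m1 \x m2)%E ((fun p => (f1 p.1, f2 p.2)) @^-1` A)%classic =
  ((k1%:num * k2%:num)%:E * (m1 \x m2)%E A)%E.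
Proof.
move=> mf1 h1 h2 A mA; rewrite /product_measure1.
have mx := measurable_fun_xsection m2 mA.
(* The section at [x] of the preimage is the [f2]-preimage of the section of [A] at [f1 x], which
   yields the factor [k2]. Pushing [m1] forward along [f1] then yields [k1]. *)
transitivity (\int[m1]_x (k2%:num%:E * ((m2 \o xsection A) \o f1) x))%E.
  apply: eq_integral => x _ /=; rewrite -h2; last exact: measurable_xsection.
  by congr (m2 _); apply/seteqP; split => y /=; rewrite /xsection/= !inE.
rewrite ge0_integralZl//; last first.
  by apply: (measurableT_comp mx).
rewrite mulrC EFinM -muleA; congr (_ * _)%E.
rewrite -[X in (\int[m1]_(x in X) _)%E](@preimage_setT _ _ f1).
rewrite -(@ge0_integral_pushforward _ _ _ _ R f1)//.
rewrite -ge0_integral_mscale//.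
by apply: eq_measure_integral => //= B mB _; rewrite /pushforward /mscale/= h1.
Qed.

(** By uniqueness of Lebesgue measure: [c] times its pushforward under multiplication by [c] gives
    each half-open interval its length. *)
Lemma lebesgue_measure_preimageZ (R : realType) (c : R) (A : set R) : 0 < c ->
  measurable A ->
  lebesgue_measure ((fun x => c * x) @^-1` A)%classic = ((c^-1)%:E * lebesgue_measure A)%E.
Proof.
move=> c0 mA.
have mc : measurable_fun [set: measurableTypeR R] (fun x : measurableTypeR R => c * x : measurableTypeR R).
  exact: measurable_funM.
pose k : {nonneg R} := NngNum (ltW c0).
pose f : {mfun measurableTypeR R >-> measurableTypeR R} :=
  HB.pack (fun x : measurableTypeR R => c * x : measurableTypeR R)
    (isMeasurableFun.Build _ _ _ _ _ mc).
have := @lebesgue_measure_unique R (mscale k (pushforward lebesgue_measure f)) _ A mA.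
rewrite /mscale /pushforward /= => ->.
  by rewrite muleA -EFinM mulVf ?mul1e// gt_eqF.
move=> X [[a b] /= _ <-].
rewrite /mscale/=.
rewrite [X in _ = (_ * lebesgue_measure X)%E](_ : _ =
    `](c^-1 * a), (c^-1 * b)]%classic); last first.
  by apply/seteqP; split => x; rewrite /= !in_itv/= ltr_pdivrMl// ler_pdivlMl.
rewrite !lebesgue_measure_itv/= !lte_fin ltr_pM2l ?invr_gt0//.
case: ifP => _; last by rewrite mule0.
by rewrite -!EFinB -EFinM mulrBr !mulrA divff ?mul1r ?gt_eqF.
Qed.

Lemma measurable_fun_scalerV (R : realType) n (c : R) :
  measurable_fun [set: 'rV[R]_n] (fun x : 'rV[R]_n => c *: x).
Proof.
apply: measurable_fun_rVP => i; under eq_fun do rewrite mxE.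
by apply: measurable_funM => //; exact: measurable_rV_coord.
Qed.

Lemma lebesgue_rV_preimageZ (R : realType) n (c : R) (A : set 'rV[R]_n) :
  0 < c -> measurable A ->
  lebesgue_rV n ((fun x => c *: x) @^-1` A)%classic =
  ((c^-1 ^+ n)%:E * lebesgue_rV n A)%E.
Proof.
move=> c0; elim: n A => [|n IH] A mA.
  rewrite expr0 mul1e; congr (lebesgue_rV 0 _).
  by apply/seteqP; split => x; rewrite /= [_ *: x]thinmx0 [x]thinmx0.
have c0' : 0 <= c^-1 by rewrite invr_ge0 ltW.
rewrite /= /lebesgue_rV_step /pushforward.
(* Prepending a coordinate commutes with dilation, so the induction step reduces to a dilation of
   each factor of the product measure. *)
have consZ (x : R) (v : 'rV[R]_n) : rV_cons (c * x, c *: v) = c *: rV_cons (x, v).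
  by apply/rowP => i; rewrite !mxE; case: unliftP => [j _|_]; rewrite ?mxE.
rewrite (_ : (_ @^-1` (_ @^-1` A))%classic =
    ((fun p : R * 'rV[R]_n => (c * p.1, c *: p.2)) @^-1`
      (@rV_cons R n @^-1` A))%classic).
  rewrite exprS (@product_measure1_preimage _ _ _ _ R lebesgue_measure
    (lebesgue_rV n) (fun x => c * x) (fun x => c *: x) (NngNum c0')
    (NngNum (exprn_ge0 n c0'))) //.
  - by apply: measurable_funM.
  - by move=> B mB; exact: lebesgue_measure_preimageZ.
  - rewrite -[X in measurable X]setTI.
    exact: measurable_rV_cons.
by apply/seteqP; split => -[x v] /=; rewrite consZ.
Qed.

(** * The Euclidean norm and its balls *)

Section euclidean_norm.
Context (R : realType) (n : nat).
Implicit Types x y : 'rV[R]_n.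

Lemma norm2_ge0 x : 0 <= norm2 x. Proof. exact: sqrtr_ge0. Qed.

Lemma sqr_norm2 x : norm2 x ^+ 2 = \sum_i x ord0 i ^+ 2.
Proof. by rewrite sqr_sqrtr// sumr_ge0// => i _; exact: sqr_ge0. Qed.

Lemma norm2Z c x : norm2 (c *: x) = `|c| * norm2 x.
Proof.
rewrite /norm2 -sqrtr_sqr -sqrtrM ?sqr_ge0// mulr_sumr.
by congr Num.sqrt; apply: eq_bigr => i _; rewrite mxE exprMn.
Qed.

Lemma norm2N x : norm2 (- x) = norm2 x.
Proof. by rewrite -scaleN1r norm2Z normrN1 mul1r. Qed.

Lemma cauchy_schwarz_rV x y :
  \sum_i x ord0 i * y ord0 i <= norm2 x * norm2 y.
Proof.
have [x0|xn0] := eqVneq (norm2 x) 0.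
  have /eqP : \sum_i x ord0 i ^+ 2 = 0 by rewrite -sqr_norm2 x0 expr0n.
  rewrite psumr_eq0 => [/allP h|i _]; last exact: sqr_ge0.
  rewrite x0 mul0r big1// => i _; have := h i (mem_index_enum _).
  by rewrite /= sqrf_eq0 => /eqP ->; rewrite mul0r.
have [y0|yn0] := eqVneq (norm2 y) 0.
  have /eqP : \sum_i y ord0 i ^+ 2 = 0 by rewrite -sqr_norm2 y0 expr0n.
  rewrite psumr_eq0 => [/allP h|i _]; last exact: sqr_ge0.
  rewrite y0 mulr0 big1// => i _; have := h i (mem_index_enum _).
  by rewrite /= sqrf_eq0 => /eqP ->; rewrite mulr0.
have xy0 : 0 < norm2 x * norm2 y.
  by rewrite mulr_gt0// lt_def norm2_ge0 ?xn0 ?yn0.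
(* Expanding this sum of squares gives [2 * P * (P - S) >= 0], where [P] is the product of the norms
   and [S] the inner product; dividing by [P > 0] finishes. *)
have : 0 <= \sum_i (norm2 y * x ord0 i - norm2 x * y ord0 i) ^+ 2.
  by apply: sumr_ge0 => i _; exact: sqr_ge0.
rewrite (eq_bigr (fun i => norm2 y ^+ 2 * x ord0 i ^+ 2 +
  norm2 x ^+ 2 * y ord0 i ^+ 2 +
  (- (2 * (norm2 x * norm2 y))) * (x ord0 i * y ord0 i))); last by move=> i _; ring.
rewrite !big_split/= -!mulr_sumr -!sqr_norm2 => h.
rewrite -(ler_pM2l xy0); nra.
Qed.

Lemma norm2D x y : norm2 (x + y) <= norm2 x + norm2 y.
Proof.
rewrite -ler_sqr ?nnegrE ?addr_ge0 ?norm2_ge0// sqr_norm2.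
rewrite (eq_bigr (fun i => x ord0 i ^+ 2 + y ord0 i ^+ 2 +
  2 * (x ord0 i * y ord0 i))); last by move=> i _; rewrite mxE; ring.
rewrite !big_split/= -mulr_sumr -!sqr_norm2.
by have := cauchy_schwarz_rV x y; nra.
Qed.

Lemma norm2_le_coord x c : 0 <= c -> (forall i, `|x ord0 i| <= c) ->
  norm2 x <= c * Num.sqrt n%:R.
Proof.
move=> c0 xc; rewrite -ler_sqr ?nnegrE ?mulr_ge0 ?sqrtr_ge0 ?norm2_ge0//.
rewrite sqr_norm2 exprMn sqr_sqrtr// mulr_natr -[n in leRHS]card_ord -sumr_const.
by apply: ler_sum => i _; rewrite -real_normK ?num_real// lerXn2r ?nnegrE.
Qed.

Lemma measurable_ball2 (r : R) : measurable (ball2 n r).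
Proof.
(* A negative radius gives the empty ball and is set apart, since comparing squares is only faithful
   for [r >= 0]. *)
have [r0|r0] := leP 0 r; last first.
  rewrite (_ : ball2 n r = set0)//; apply/seteqP; split => x //=.
  by rewrite /ball2/= leNgt (lt_le_trans r0 (norm2_ge0 x)).
rewrite (_ : ball2 n r = ((fun x : 'rV[R]_n => \sum_i x ord0 i ^+ 2) @^-1`
    `]-oo, r ^+ 2]))%classic.
  rewrite -[X in measurable X]setTI.
  apply: measurable_sum => // i.
  by apply: (measurable_funX 2); exact: measurable_rV_coord.
apply/seteqP; split => x;
  by rewrite /ball2/= in_itv/= -sqr_norm2 ler_sqr ?nnegrE ?norm2_ge0.
Qed.

Lemma ball2_preimageZ (r : R) : 0 < r ->
  ball2 n r = ((fun x => r^-1 *: x) @^-1` ball2 n 1)%classic.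
Proof.
move=> r0; apply/seteqP; split => x;
  by rewrite /ball2/= norm2Z gtr0_norm ?invr_gt0// ler_pdivrMl// mulr1.
Qed.

End euclidean_norm.

(** * The tiling by unit cubes centred at integer points *)

Section integer_cubes.
Context (R : realType) (n : nat).
Implicit Types a b x : 'rV[R]_n.

(** Half-open sides make the cubes an exact partition of the space, with no overlap on the faces. *)
Definition unit_cube a : set 'rV[R]_n :=
  [set x | forall i, `[a ord0 i - 2^-1, a ord0 i + 2^-1[%classic (x ord0 i)]%classic.

Lemma measurable_unit_cube a : measurable (unit_cube a).
Proof.
rewrite (_ : unit_cube a = \bigcap_(i in [set: 'I_n])
    ((@rV_coord _ R n i) @^-1` `[a ord0 i - 2^-1, a ord0 i + 2^-1[))%classic.
  apply: fin_bigcap_measurable => // i _.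
  rewrite -[X in measurable X]setTI; exact: measurable_rV_coord.
by apply/seteqP; split => x xa i => [_|]; exact: xa.
Qed.

Lemma lebesgue_rV_unit_cube a : lebesgue_rV n (unit_cube a) = 1%E.
Proof.
rewrite [LHS](@lebesgue_rV_box R n
  (fun i => `[a ord0 i - 2^-1, a ord0 i + 2^-1[%classic))// big1// => i _.
rewrite lebesgue_measure_itv/= lte_fin ltrD2l.
rewrite (_ : - 2^-1 < 2^-1); last by lra.
by rewrite -EFinB; congr EFin; lra.
Qed.

(** Coordinates of two centres sharing a point differ by strictly less than 1, because the sides are
    half-open; being integers, they agree. *)
Lemma unit_cube_inj a b x : integer_points n a -> integer_points n b ->
  unit_cube a x -> unit_cube b x -> a = b.
Proof.
move=> az bz ax bx; apply/rowP => i.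
have /intrP[k ak] := az i; have /intrP[l bl] := bz i.
have := ax i; have := bx i; rewrite /= !in_itv/= ak bl => /andP[h1 h2] /andP[h3 h4].
have kl : (k < l + 1)%R by rewrite -(ltr_int R) rmorphD/=; lra.
have lk : (l < k + 1)%R by rewrite -(ltr_int R) rmorphD/=; lra.
by congr (_%:~R); apply/eqP; rewrite eq_le -!ltzD1 kl lk.
Qed.

(** Ties round up, matching the closed left and open right ends of [unit_cube]. *)
Definition nearest x : 'rV[R]_n := \row_i (Num.floor (x ord0 i + 2^-1))%:~R.

Lemma integer_points_nearest x : integer_points n (nearest x).
Proof. by move=> i; rewrite mxE intr_int. Qed.

Lemma unit_cube_nearest x : unit_cube (nearest x) x.
Proof.
move=> i; rewrite /= mxE in_itv/=.
have := floor_itv (x ord0 i + 2^-1).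
by rewrite rmorphD/= => /andP[? ?]; apply/andP; split; lra.
Qed.

Lemma unit_cube_coord a x i : unit_cube a x -> `|x ord0 i - a ord0 i| <= 2^-1.
Proof. by move=> /(_ i); rewrite /= in_itv/= ler_norml => /andP[? ?]; lra. Qed.

Lemma norm2_sub_unit_cube a x : unit_cube a x ->
  norm2 (x - a) <= 2^-1 * Num.sqrt n%:R.
Proof.
by move=> ax; apply: norm2_le_coord => // i; rewrite !mxE; exact: unit_cube_coord.
Qed.

Lemma norm2_sub_unit_cube3 a1 a2 a3 x1 x2 x3 :
  unit_cube a1 x1 -> unit_cube a2 x2 -> unit_cube a3 x3 ->
  norm2 ((x1 + x2 - x3) - (a1 + a2 - a3)) <= 3 / 2 * Num.sqrt n%:R.
Proof.
move=> h1 h2 h3; apply: norm2_le_coord => // i; rewrite !mxE.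
have := unit_cube_coord i h1; have := unit_cube_coord i h2.
have := unit_cube_coord i h3; rewrite !ler_norml.
by move=> /andP[? ?] /andP[? ?] /andP[? ?]; apply/andP; split; lra.
Qed.

Lemma ball2_near x y r e : norm2 (x - y) <= e -> ball2 n r y -> ball2 n (r + e) x.
Proof.
rewrite /ball2/= => xy yr; rewrite -[x](subrK y) [r + e]addrC.
by rewrite (le_trans (norm2D _ _))// lerD.
Qed.

End integer_cubes.

Lemma mem_lattice_ball (R : realType) n (r : R) (a : 'rV[R]_n) :
  (a \in lattice_ball n r) = (a \in (integer_points n `&` ball2 n r)%classic).
Proof. by rewrite in_fset_set; last exact: finite_lattice_ball. Qed.

(** * Continuous energy as a measure, and its homogeneity in the radius *)

Section energy_set.
Context (R : realType) (n : nat).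
Local Notation mu := (lebesgue_rV n : {sigma_finite_measure set 'rV[R]_n -> \bar R}).
Local Notation mu3 := ((mu \x mu) \x mu)%E.

Definition energy_set (r : R) : set ('rV[R]_n * 'rV[R]_n * 'rV[R]_n) :=
  [set p | [/\ ball2 n r p.1.1, ball2 n r p.1.2, ball2 n r p.2 &
    ball2 n r (p.1.1 + p.1.2 - p.2)]]%classic.

Lemma measurable_energy_set r : measurable (energy_set r).
Proof.
have m11 : measurable_fun setT (fun p : 'rV[R]_n * 'rV[R]_n * 'rV[R]_n => p.1.1).
  exact: (measurableT_comp measurable_fst).
have m12 : measurable_fun setT (fun p : 'rV[R]_n * 'rV[R]_n * 'rV[R]_n => p.1.2).
  exact: (measurableT_comp measurable_snd).
have m2 : measurable_fun setT (fun p : 'rV[R]_n * 'rV[R]_n * 'rV[R]_n => p.2).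
  exact: measurable_snd.
have m4 : measurable_fun setT
    (fun p : 'rV[R]_n * 'rV[R]_n * 'rV[R]_n => p.1.1 + p.1.2 - p.2).
  apply: measurable_fun_rVP => i; under eq_fun do rewrite !mxE.
  apply: measurable_funB; [apply: measurable_funD|].
  - exact: (measurableT_comp (measurable_rV_coord i) m11).
  - exact: (measurableT_comp (measurable_rV_coord i) m12).
  - exact: (measurableT_comp (measurable_rV_coord i) m2).
have mB : measurable (ball2 n r) by exact: measurable_ball2.
rewrite (_ : energy_set r =
  ([set: 'rV[R]_n * 'rV[R]_n * 'rV[R]_n] `&` (fun p => p.1.1) @^-1` ball2 n r) `&`
  (setT `&` (fun p => p.1.2) @^-1` ball2 n r) `&`
  (setT `&` (fun p => p.2) @^-1` ball2 n r) `&`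
  (setT `&` (fun p => p.1.1 + p.1.2 - p.2) @^-1` ball2 n r))%classic.
  by apply: measurableI; [apply: measurableI; [apply: measurableI|]|];
    [exact: m11|exact: m12|exact: m2|exact: m4].
by rewrite !setTI; apply/seteqP; split => p /= => [[]|[[[]]]].
Qed.

(** The product of the four indicators is the indicator of [energy_set r]. *)
Lemma continuous_energyE r : continuous_energy (ball2 n r) = mu3 (energy_set r).
Proof.
rewrite -[in RHS](setIT (energy_set r)) -integral_indic//; last exact: measurable_energy_set.
apply: eq_integral => p _; congr EFin; rewrite !indicE -!natrM !mulnb.
congr ((nat_of_bool _)%:R); apply/idP/idP.
  move=> /andP[/andP[/andP[/set_mem ? /set_mem ?] /set_mem ?] /set_mem ?].
  exact/mem_set.
by move=> /set_mem[*]; rewrite !mem_set.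
Qed.

Lemma lebesgue_ball2 r : 0 < r ->
  mu (ball2 n r) = ((r ^+ n)%:E * mu (ball2 n 1))%E.
Proof.
move=> r0; rewrite ball2_preimageZ// lebesgue_rV_preimageZ ?invr_gt0 ?invrK//.
exact: measurable_ball2.
Qed.

(** The four conditions are invariant under dilating all three variables and the radius together;
    each variable contributes a factor [r ^+ n]. *)
Lemma measure_energy_set r : 0 < r ->
  mu3 (energy_set r) = ((r ^+ (3 * n))%:E * mu3 (energy_set 1))%E.
Proof.
move=> r0; pose k := NngNum (exprn_ge0 n (ltW r0)).
pose k2 := NngNum (exprn_ge0 (n + n) (ltW r0)).
have r0' : 0 < r^-1 by rewrite invr_gt0.
pose f (x : 'rV[R]_n) := r^-1 *: x.
have mf : measurable_fun setT f by exact: measurable_fun_scalerV.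
have h A : measurable A -> mu (f @^-1` A)%classic = (k%:num%:E * mu A)%E.
  by move=> mA; rewrite /f lebesgue_rV_preimageZ// invrK.
have h2 A : measurable A ->
    (mu \x mu)%E ((fun p => (f p.1, f p.2)) @^-1` A)%classic =
    (k2%:num%:E * (mu \x mu) A)%E.
  rewrite /= exprD; exact: (product_measure1_preimage (m1 := mu) mf h h).
have mff : measurable_fun setT (fun p : 'rV[R]_n * 'rV[R]_n => (f p.1, f p.2)).
  apply/measurable_fun_pair; first exact: (measurableT_comp mf measurable_fst).
  exact: (measurableT_comp mf measurable_snd).
have := product_measure1_preimage (m1 := (mu \x mu)%E) mff h2 h (measurable_energy_set 1).
rewrite /= -!exprD (_ : n + n + n = 3 * n)%N; last by lia.
move=> <-; congr (product_measure1 _ _ _).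
rewrite /energy_set; apply/seteqP; split => -[[x y] z] /=;
  by rewrite !(ball2_preimageZ n r0)/= /f scalerBr scalerDr.
Qed.

End energy_set.
Arguments energy_set {R} n r _.

(** * Comparison of lattice counts with volumes and continuous energies *)

Section lattice_counting.
Context (R : realType) (n : nat) (r : R).
Local Notation mu := (lebesgue_rV n : {sigma_finite_measure set 'rV[R]_n -> \bar R}).
Local Notation mu3 := ((mu \x mu) \x mu)%E.
Local Notation s := (Num.sqrt n%:R : R).

Lemma card_lattice_ball_le :
  ((#|` lattice_ball n r|%:R)%:E <= mu (ball2 n (r + 2^-1 * s)))%E.
Proof.
apply: (@card_le_measure _ _ _ mu _ _ (@unit_cube R n)).
- by move=> a _; exact: measurable_unit_cube.
- by move=> a _; exact: lebesgue_rV_unit_cube.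
- exact: measurable_ball2.
- move=> a b /=; rewrite !mem_lattice_ball !inE => -[az _] [bz _] [x [ax bx]].
  exact: unit_cube_inj ax bx.
- move=> a; rewrite mem_lattice_ball inE => -[_ ar] x ax.
  by apply: ball2_near ar; exact: norm2_sub_unit_cube.
Qed.

Lemma le_card_lattice_ball :
  (mu (ball2 n (r - 2^-1 * s)) <= (#|` lattice_ball n r|%:R)%:E)%E.
Proof.
apply: (@measure_le_card _ _ _ mu _ _ (@unit_cube R n)).
- by move=> a _; exact: measurable_unit_cube.
- by move=> a _; exact: lebesgue_rV_unit_cube.
- exact: measurable_ball2.
- move=> x xr; exists (nearest x); last exact: unit_cube_nearest.
  rewrite /= mem_lattice_ball inE; split; first exact: integer_points_nearest.
  rewrite -[r](subrK (2^-1 * s)); apply: ball2_near xr.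
  rewrite -norm2N opprB; exact/norm2_sub_unit_cube/unit_cube_nearest.
Qed.

Local Notation V := 'rV[R]_n.

(* The last entry of a quadruple is determined by the other three, so it is left
   out of the cube. *)
Definition energy_cube (q : (V * V) * (V * V)) : set (V * V * V) :=
  ((unit_cube q.1.1 `*` unit_cube q.1.2) `*` unit_cube q.2.1)%classic.

(** The set counted by [additive_energy], named to serve as the index set of the cells
    [energy_cube]. *)
Definition energy_quadruples :=
  [fset q in (lattice_ball n r `*` lattice_ball n r) `*`
     (lattice_ball n r `*` lattice_ball n r) |
     (q.1.1 + q.1.2 == q.2.1 + q.2.2)%R]%fset.

Lemma mem_energy_quadruples q : q \in energy_quadruples <->
  [/\ integer_points n q.1.1 /\ ball2 n r q.1.1,
      integer_points n q.1.2 /\ ball2 n r q.1.2,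
      integer_points n q.2.1 /\ ball2 n r q.2.1 &
      integer_points n q.2.2 /\ ball2 n r q.2.2] /\
  q.1.1 + q.1.2 - q.2.1 = q.2.2.
Proof.
rewrite !inE /= !mem_lattice_ball; split.
  move=> /andP[/andP[/andP[/set_mem h1 /set_mem h2]] /andP[/set_mem h3 /set_mem h4]].
  by move=> /eqP h; split=> //; rewrite h addrAC subrr add0r.
move=> [[h1 h2 h3 h4] h].
have -> : q.1.1 + q.1.2 == q.2.1 + q.2.2 by rewrite -h [eqbRHS]addrC subrK.
by rewrite !mem_set.
Qed.

Lemma measurable_energy_cube q : measurable (energy_cube q).
Proof.
by apply: measurableX; [apply: measurableX|]; exact: measurable_unit_cube.
Qed.

Lemma measure_energy_cube q : mu3 (energy_cube q) = 1%E.
Proof.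
have mc := @measurable_unit_cube R n.
rewrite /energy_cube product_measure1E; [|by apply: measurableX; exact: mc|exact: mc].
rewrite [X in (X * _)%E]product_measure1E; [|exact: mc|exact: mc].
transitivity (1 * 1 * 1 : \bar R)%E; last by rewrite !mule1.
by congr (_ * _ * _)%E; exact: lebesgue_rV_unit_cube.
Qed.

Lemma additive_energy_le :
  ((additive_energy (lattice_ball n r))%:R%:E <=
   mu3 (energy_set n (r + 3 / 2 * s)))%E.
Proof.
have s0 : 0 <= s by exact: sqrtr_ge0.
apply: (@card_le_measure _ _ _ mu3 _ energy_quadruples energy_cube).
- by move=> q _; exact: measurable_energy_cube.
- by move=> q _; exact: measure_energy_cube.
- exact: measurable_energy_set.
- move=> q q' /= /mem_energy_quadruples[[[a1 _] [a2 _] [a3 _] _] a4]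
    /mem_energy_quadruples[[[b1 _] [b2 _] [b3 _] _] b4].
  (* A common point forces the first three entries to agree, and the additive relation then forces
     the fourth. *)
  case=> p [[[p1 p2] p3] [[p1' p2'] p3']].
  move: a4 b4; rewrite (unit_cube_inj a1 b1 p1 p1').
  rewrite (unit_cube_inj a2 b2 p2 p2') (unit_cube_inj a3 b3 p3 p3') => a4 b4.
  rewrite (surjective_pairing q) (surjective_pairing q.1) (surjective_pairing q.2).
  rewrite (surjective_pairing q') (surjective_pairing q'.1) (surjective_pairing q'.2).
  congr ((_, _), (_, _)); first exact: unit_cube_inj p1 p1'.
  - exact: unit_cube_inj p2 p2'.
  - exact: unit_cube_inj p3 p3'.
  - by rewrite -a4 -b4.
- move=> q /mem_energy_quadruples[[[_ b1] [_ b2] [_ b3] [_ b4]] q4] p [[p1 p2] p3].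
  (* The first three entries move by at most [s / 2] and only the fourth by [3 / 2 * s]; all are
     relaxed to the larger bound because [energy_set] has a single radius. *)
  have le_e x y : norm2 (x - y) <= 2^-1 * s -> norm2 (x - y : V) <= 3 / 2 * s.
    by move=> xy; rewrite (le_trans xy)//; nra.
  split; [apply: ball2_near b1|apply: ball2_near b2|apply: ball2_near b3|apply: ball2_near b4].
  - exact/le_e/norm2_sub_unit_cube.
  - exact/le_e/norm2_sub_unit_cube.
  - exact/le_e/norm2_sub_unit_cube.
  - by rewrite -q4; exact: norm2_sub_unit_cube3.
Qed.

Lemma le_additive_energy :
  (mu3 (energy_set n (r - 3 / 2 * s)) <=
   (additive_energy (lattice_ball n r))%:R%:E)%E.
Proof.
have s0 : 0 <= s by exact: sqrtr_ge0.
apply: (@measure_le_card _ _ _ mu3 _ energy_quadruples energy_cube).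
- by move=> q _; exact: measurable_energy_cube.
- by move=> q _; exact: measure_energy_cube.
- exact: measurable_energy_set.
move=> [[x y] z] [/= xr yr zr tr].
have xz := @integer_points_nearest R n.
(* The fourth entry is not [nearest (x + y - z)]: this choice makes the additive relation exact, at
   the price of an error of [3 / 2 * s]. *)
exists ((nearest x, nearest y), (nearest z, nearest x + nearest y - nearest z)).
  apply/mem_energy_quadruples => /=; split => //.
  have le_e (w : V) : norm2 (nearest w - w) <= 3 / 2 * s.
    rewrite -norm2N opprB (le_trans (norm2_sub_unit_cube (unit_cube_nearest w)))//.
    by nra.
  rewrite -[r](subrK (3 / 2 * s)); split; split => //.
  - exact: ball2_near xr.
  - exact: ball2_near yr.
  - exact: ball2_near zr.
  - by move=> i; have := (xz x i, xz y i, xz z i); rewrite !mxE => -[[? ?] ?]; rewrite rpredB ?rpredD.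
  - apply: ball2_near tr; rewrite -norm2N opprB.
    by apply: norm2_sub_unit_cube3; exact: unit_cube_nearest.
by split; [split|]; exact: unit_cube_nearest.
Qed.

End lattice_counting.

(** * From two-sided bounds to logarithms *)

Lemma fine_sandwich (R : realType) (x : \bar R) (a b c : R) :
  (0 <= x)%E -> 0 < a -> 0 < b -> 0 < c ->
  (a%:E * x <= c%:E)%E -> (c%:E <= b%:E * x)%E ->
  [/\ 0 < fine x, a * fine x <= c & c <= b * fine x].
Proof.
move=> x0 a0 b0 c0 axc cbx.
(* Finiteness comes from the upper bound on [a%:E * x]. Below, positivity comes from
   [0 < c <= b * fine x]. Thus neither the ball's volume nor its energy has to be computed. *)
have xfin : x \is a fin_num.
  rewrite ge0_fin_numE// ltey; apply/eqP => xy; move: axc.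
  by rewrite xy gt0_muley ?lte_fin// leye_eq.
move: axc cbx; rewrite -(fineK xfin) -!EFinM !lee_fin /= => axc cbx.
by split=> //; rewrite -(pmulr_rgt0 _ b0) (lt_le_trans c0).
Qed.

Lemma ln_sandwich (R : realType) (a b c x : R) (m : nat) :
  0 < a -> 0 < b -> 0 < c -> 0 < x -> a ^+ m * x <= c -> c <= b ^+ m * x ->
  m%:R * ln a <= ln c - ln x <= m%:R * ln b.
Proof.
move=> a0 b0 c0 x0 axc cbx.
have pw y : 0 < y -> m%:R * ln y = ln (y ^+ m * x) - ln x.
  by move=> y0; rewrite lnM ?posrE ?exprn_gt0// addrK lnXn// mulr_natl.
by rewrite !pw// !lerD2r !ler_ln ?posrE ?mulr_gt0 ?exprn_gt0// axc.
Qed.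

(** This is [ln (1 + t) <= t] at [t = (x - y) / y]. *)
Lemma lnB_le (R : realType) (x y : R) : 0 < x -> 0 < y -> ln x - ln y <= (x - y) / y.
Proof.
move=> x0 y0; rewrite -ln_div ?posrE//.
have -> : x / y = 1 + (x - y) / y by field; rewrite gt_eqF.
by apply: le_ln1Dx; rewrite mulrBl divff ?gt_eqF// ltrBrDr addrC subrr divr_gt0.
Qed.

(** * Positivity of both counts, witnessed by the origin *)

Section origin.
Context (R : realType) (n : nat) (r : R).
Hypothesis r0 : 0 <= r.

Lemma lattice_ball0 : 0 \in lattice_ball n r.
Proof.
rewrite mem_lattice_ball mem_set//; split; first by move=> i; rewrite mxE rpred0.
by rewrite /ball2/= -(scale0r (0 : 'rV[R]_n)) norm2Z normr0 mul0r.
Qed.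

Lemma card_lattice_ball_gt0 : (0 < #|` lattice_ball n r|)%N.
Proof. by rewrite cardfs_gt0; apply/fset0Pn; exists 0; exact: lattice_ball0. Qed.

Lemma additive_energy_gt0 : (0 < additive_energy (lattice_ball n r))%N.
Proof.
rewrite cardfs_gt0; apply/fset0Pn; exists ((0, 0), (0, 0)).
by rewrite !inE/= !lattice_ball0 eqxx.
Qed.

End origin.

(** The quantity is [(ln E - ln W) - 3 * (ln N - ln V)]. Each one-sided bound is [3 * m] times a
    difference of logarithms of radii [2 * s] apart, and each difference is at most [4 * (s / r)],
    whence 12. *)
Lemma ln_ratio_bound (R : realType) (m r s N E V W : R) :
  0 <= m -> 0 < s -> 3 * s <= r -> 0 < N -> 0 < E -> 0 < V -> 0 < W ->
  m * ln (r - 2^-1 * s) <= ln N - ln V <= m * ln (r + 2^-1 * s) ->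
  3 * m * ln (r - 3 / 2 * s) <= ln E - ln W <= 3 * m * ln (r + 3 / 2 * s) ->
  `|ln (E / N ^+ 3) - ln (W / V ^+ 3)| <= 12 * (m * s / r).
Proof.
move=> m0 s0 sr N0 E0 V0 W0 /andP[NV1 NV2] /andP[EW1 EW2].
rewrite !ln_div ?posrE ?exprn_gt0// !lnXn//.
rewrite -[ln N *+ 3]mulr_natl -[ln V *+ 3]mulr_natl.
have r0 : 0 < r by lra.
(* The smaller radius is at least [r - 3 / 2 * s >= r / 2], as [3 * s <= r]; so
   [2 * s / y <= 4 * (s / r)]. *)
have near (x y : R) : 0 < x -> r / 2 <= y -> x - y = 2 * s ->
    ln x - ln y <= 4 * (s / r).
  move=> x0 yr xy; have y0 : 0 < y by rewrite (lt_le_trans _ yr)// divr_gt0.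
  rewrite (le_trans (lnB_le x0 y0))// xy ler_pdivrMr//.
  rewrite (_ : 2 * s = 4 * (s / r) * (r / 2)); last by field; rewrite gt_eqF.
  by rewrite ler_pM2l// mulr_gt0// divr_gt0.
have up : ln (r + 3 / 2 * s) - ln (r - 2^-1 * s) <= 4 * (s / r) by apply: near; lra.
have dn : ln (r + 2^-1 * s) - ln (r - 3 / 2 * s) <= 4 * (s / r) by apply: near; lra.
have := ler_wpM2l m0 up; have := ler_wpM2l m0 dn.
rewrite -[m * s / r]mulrA; set q := s / r => dn' up'.
by rewrite ler_norml; apply/andP; split; lra.
Qed.

(** * The logarithmic comparison of discrete and continuous energies *)

Theorem proposition3p3 (R : realType) (d : nat) (r : R)
    (hd : (1 <= d)%N) (hr : 3 * Num.sqrt d%:R <= r) :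
  `| ln ((additive_energy (lattice_ball d r))%:R
         / (#|` lattice_ball d r|)%:R ^+ 3)
     - ln (normalized_ball_energy R d) | <= 12 * (d%:R `^ (3 / 2) / r).
Proof.
have s0 : 0 < Num.sqrt d%:R :> R by rewrite sqrtr_gt0 ltr0n.
have -> : d%:R `^ (3 / 2) = d%:R * Num.sqrt d%:R :> R.
  rewrite (_ : 3 / 2 = 1 + 2^-1); last by field.
  by rewrite powRD ?pnatr_eq0 -?lt0n ?hd ?implybT// powRr1// powR12_sqrt.
have r0 : 0 <= r by lra.
have N0 : 0 < (#|` lattice_ball d r|)%:R :> R.
  by rewrite ltr0n card_lattice_ball_gt0.
have E0 : 0 < (additive_energy (lattice_ball d r))%:R :> R.
  by rewrite ltr0n additive_energy_gt0.
have a0 : 0 < r - 3 / 2 * Num.sqrt d%:R by lra.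
have b0 : 0 < r - 2^-1 * Num.sqrt d%:R by lra.
have a0' : 0 < r + 3 / 2 * Num.sqrt d%:R by lra.
have b0' : 0 < r + 2^-1 * Num.sqrt d%:R by lra.
have := le_card_lattice_ball d r; rewrite lebesgue_ball2// => Nge.
have := card_lattice_ball_le d r; rewrite lebesgue_ball2// => Nle.
have := le_additive_energy d r; rewrite measure_energy_set// => Ege.
have := additive_energy_le d r; rewrite measure_energy_set// => Ele.
(* Here the unknown [x] is the unit ball's volume, and next its continuous energy; their [fine]
   parts are those in [normalized_ball_energy]. *)
have [V0 V1 V2] :=
  fine_sandwich (measure_ge0 _ _) (exprn_gt0 _ b0) (exprn_gt0 _ b0') N0 Nge Nle.
have [W0 W1 W2] :=
  fine_sandwich (measure_ge0 _ _) (exprn_gt0 _ a0) (exprn_gt0 _ a0') E0 Ege Ele.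
have NV := ln_sandwich b0 b0' N0 V0 V1 V2.
have EW := ln_sandwich a0 a0' E0 W0 W1 W2.
rewrite natrM in EW; rewrite /normalized_ball_energy continuous_energyE.
exact: ln_ratio_bound (ler0n _ d) s0 hr N0 E0 V0 W0 NV EW.
Qed.
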